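(* Let $D$ be an ordinary Steiner system (the case $q=1$) or a $q$-analog Steiner system ($q$ a prime power) with parameters $t$-$(v,k,1)_q$. For each block $B\in D$, the block intersection distribution at $B$ is given by $$\alpha_i(B)=\begin{cases}\displaystyle\genfrac{[}{]}{0pt}{}{k}{i}_q\sum_{j=0}^{t-i-1}(-1)^jq^{\binom{j}{2}}\genfrac{[}{]}{0pt}{}{k-i}{j}_q\left(\frac{\genfrac{[}{]}{0pt}{}{v-i-j}{v-k}_q}{\genfrac{[}{]}{0pt}{}{v-t}{v-k}_q}-1\right)&\text{if }i\in\{0,\ldots,t-1\},\\ 0&\text{if }i\in\{t,\ldots,k-1\},\\ 1&\text{if }i=k.\end{cases}$$ In particular, the block intersection distribution is uniquely determined by the parameters $v$, $k$, $t$, and, in the $q$-analog case, $q$.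
   Context: Let $0\le t\le k\le v$ be integers. An ordinary Steiner system with parameters $t$-$(v,k,1)$ (also written $t$-$(v,k,1)_1$) is a set $D$ of $k$-element subsets (blocks) of a $v$-element set $V$ such that every $t$-element subset of $V$ is contained in exactly one element of $D$. For a prime power $q$, a $q$-analog Steiner system with parameters $t$-$(v,k,1)_q$ is a set $D$ of $k$-dimensional subspaces (blocks) of a $v$-dimensional $\mathbb{F}_q$-vector space $V$ such that every $t$-dimensional subspace of $V$ is contained in exactly one element of $D$. For $B\in D$ and $i\in\{0,\ldots,k\}$, $\alpha_i(B)$ is the number of $B'\in D$ with $\#(B\cap B')=i$ in the ordinary case, respectively $\dim(B\cap B')=i$ in the $q$-analog case. The sequence $(\alpha_0(B),\ldots,\alpha_k(B))$ is the block intersection distribution at $B$. $\genfrac{[}{]}{0pt}{}{a}{b}_q$ is the Gaussian binomial coefficient, which for $q=1$ is the ordinary binomial coefficient $\binom{a}{b}$. *)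

(* Defs.v *)
From HB Require Import structures.
From mathcomp Require Import all_boot all_order all_algebra.

Set Implicit Arguments.
Unset Strict Implicit.
Unset Printing Implicit Defensive.

Import Order.TTheory GRing.Theory Num.Theory.

(* The subspaces of a vector space over a finite field form a finite type, so
   that sets of subspaces and their cardinals are available through finset. *)
HB.instance Definition _ (F : finFieldType) (V : vectType F) :=
  Choice_isCountable.Build {vspace V}
    (pcan_pickleK (can_pcan (@VectorInternalTheory.vs2mxK F V))).
HB.instance Definition _ (F : finFieldType) (V : vectType F) :
    isFinite {vspace V} :=
  CanIsFinite (@VectorInternalTheory.vs2mxK F V).

Definition steiner (t v k : nat) (T : finType) (D : {set {set T}}) : Prop :=
  [/\ #|T| = v,
      forall B, B \in D -> #|B| = k
    & forall A : {set T}, #|A| = t -> exists! B, B \in D /\ A \subset B].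

Definition q_steiner (t v k q : nat) (F : finFieldType) (V : vectType F)
    (D : {set {vspace V}}) : Prop :=
  [/\ #|F| = q,
      \dim {: V} = v,
      forall B, B \in D -> \dim B = k
    & forall A : {vspace V}, \dim A = t ->
        exists! B, B \in D /\ (A <= B)%VS].

Definition alpha (T : finType) (D : {set {set T}}) (B : {set T}) (i : nat)
  : nat := #|[set B' in D | #|B :&: B'| == i]|.

Definition q_alpha (F : finFieldType) (V : vectType F) (D : {set {vspace V}})
    (B : {vspace V}) (i : nat) : nat :=
  #|[set B' in D | \dim (B :&: B')%VS == i]|.

Local Open Scope ring_scope.

Definition q_number (q n : nat) : rat := \sum_(i < n) q%:R ^+ i.

(* The product of ([a - i]_q / [i + 1]_q) for i < b, with [n]_q the q-number
   1 + q + ... + q^(n-1); this covers q = 1 uniformly. If a < b, then the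
   factor at i = a is 0. *)
Definition gauss_binom (q a b : nat) : rat :=
  \prod_(i < b) (q_number q (a - i) / q_number q i.+1).

Lemma gauss_binom_q1 (a b : nat) : gauss_binom 1 a b = 'C(a, b)%:R.
Proof.
have qn n : q_number 1 n = n%:R.
  rewrite /q_number (eq_bigr (fun=> 1)) => [|i _]; last by rewrite expr1n.
  by rewrite sumr_const card_ord.
elim: b => [|b IHb]; first by rewrite /gauss_binom big_ord0 bin0.
rewrite /gauss_binom big_ord_recr /= -/(gauss_binom 1 a b) IHb !qn mulrA.
apply: (@mulIf _ b.+1%:R); first by rewrite pnatr_eq0.
by rewrite mulfVK ?pnatr_eq0 // -!natrM mulnC -mul_bin_left mulnC.
Qed.

Lemma gauss_binom_q_gt1 (q a b : nat) : (1 < q)%N ->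
  gauss_binom q a b =
  \prod_(i < b) ((q%:R ^+ (a - i) - 1) / (q%:R ^+ i.+1 - 1)).
Proof.
move=> q_gt1; have q1 : q%:R - 1 != 0 :> rat.
  by rewrite subr_eq0 pnatr_eq1 gtn_eqF.
by apply: eq_bigr => i _; rewrite !subrX1 -mulf_div divff ?mul1r.
Qed.

(* For t <= k <= v, none of the natural-number subtractions truncates: the sum
   over j < t - i is the sum over 0 <= j <= t - i - 1. *)
Definition block_intersection_number (t v k q i : nat) : rat :=
  if (i < t)%N then
    gauss_binom q k i *
    \sum_(0 <= j < t - i)
      (-1) ^+ j * q%:R ^+ 'C(j, 2) * gauss_binom q (k - i) j *
      (gauss_binom q (v - i - j) (v - k) / gauss_binom q (v - t) (v - k) - 1)
  else if (i < k)%N then 0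
  else 1.

(* Main.v *)
From HB Require Import structures.
Require Import Defs.
From mathcomp Require Import all_boot all_order all_algebra finfield.
From mathcomp Require Import ring zify.

Set Implicit Arguments.
Unset Strict Implicit.
Unset Printing Implicit Defensive.

Import Order.TTheory GRing.Theory Num.Theory.
Local Open Scope ring_scope.

(** The two cases are one. Subsets of a finite set and subspaces of a vector
    space over a finite field are finite lattices with a rank (cardinal,
    dimension) in which, whenever x <= y, exactly [rk y - rk x]_q elements of
    the interval from x to y have rank one more than x; here q = 1 for
    subsets. This count, for a rank that increases strictly from 0, is all
    that the argument needs to know about the lattice.

    Counting the pairs (p, z) with x < p <= z <= y, rk p = rk x + 1 and
    rk z = rk x + s + 1 in two ways gives a recursion for the number of
    elements of given rank in an interval, which is solved by the Gaussian
    binomial (card_interval). Counting the pairs (z, B) with x <= z <= B and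
    rk z = t, where B runs through the blocks, then gives the number of blocks
    above x as a ratio of Gaussian binomials, depending on rk x <= t only
    (card_blocks_above).

    Fix a block B. Two distinct blocks meet in rank less than t, since the
    block above an element of rank t is unique; this settles i >= t. Counting
    the pairs (z, B') with z <= B, z <= B', rk z = j and B' <> B gives, for
    all j <= t, the sum over B' <> B of the binomials [rk (B meet B'), j]_q
    (sum_gauss_meet). These are the binomial moments of the intersection
    distribution, and Gaussian inversion recovers the distribution: the
    indicator of m = i is the sum over j of
    (-1)^j q^(j choose 2) [i + j, i]_q [m, i + j]_q (gauss_inversion), where
    the terms j < t - i suffice because m < t.

    The distribution being a formula in the parameters, it does not depend on
    the system or on the block. *)

(** * Gaussian binomials *)

Definition q_factorial (q n : nat) : rat := \prod_(i < n) q_number q i.+1.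

Lemma q_number0 q : q_number q 0 = 0.
Proof. by rewrite /q_number big_ord0. Qed.

Lemma q_numberD q m n :
  q_number q (m + n) = q_number q m + q%:R ^+ m * q_number q n.
Proof.
rewrite /q_number big_split_ord /= mulr_sumr; congr (_ + _).
by apply: eq_bigr => i _; rewrite exprD.
Qed.

Lemma q_number_geometric q n :
  q_number q n * (q%:R - 1) = q%:R ^+ n - 1.
Proof. by rewrite mulrC /q_number -subrX1. Qed.

Lemma q_number_neq0 q n : q_number q n.+1 != 0.
Proof.
rewrite /q_number big_ord_recl expr0 gt_eqF //.
rewrite ltr_wpDr // sumr_ge0 // => i _.
by rewrite exprn_ge0 // ler0n.
Qed.

Lemma q_factorialS q n : q_factorial q n.+1 = q_factorial q n * q_number q n.+1.
Proof. by rewrite /q_factorial big_ord_recr. Qed.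

Lemma q_factorial_neq0 q n : q_factorial q n != 0.
Proof. by apply/prodf_neq0 => i _; apply: q_number_neq0. Qed.

Lemma gauss_binom0 q n : gauss_binom q n 0 = 1.
Proof. by rewrite /gauss_binom big_ord0. Qed.

Lemma gauss_binom_small q n m : (n < m)%N -> gauss_binom q n m = 0.
Proof.
move=> ltnm; rewrite /gauss_binom (bigD1 (Ordinal ltnm)) //=.
by rewrite subnn q_number0 !mul0r.
Qed.

Lemma gauss_binomSr q n m :
  gauss_binom q n m.+1 =
  gauss_binom q n m * (q_number q (n - m) / q_number q m.+1).
Proof. by rewrite /gauss_binom big_ord_recr. Qed.

Lemma gauss_binom_factorial q n m :
  gauss_binom q (m + n) m =
  q_factorial q (m + n) / (q_factorial q m * q_factorial q n).
Proof.
elim: m n => [|m IHm] n.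
  by rewrite gauss_binom0 /q_factorial big_ord0 mul1r divff // q_factorial_neq0.
rewrite gauss_binomSr addSnnS IHm addnS subSn ?leq_addr // addKn !q_factorialS.
by field; rewrite !q_number_neq0 !q_factorial_neq0.
Qed.

Lemma gauss_binom_sub q n m : (m <= n)%N ->
  gauss_binom q n m =
  q_factorial q n / (q_factorial q m * q_factorial q (n - m)).
Proof. by move=> lemn; rewrite -{1 2}(subnKC lemn) gauss_binom_factorial. Qed.

Lemma gauss_binom_neq0 q n m : (m <= n)%N -> gauss_binom q n m != 0.
Proof.
move=> lemn; rewrite gauss_binom_sub // mulf_neq0 ?q_factorial_neq0 //.
by rewrite invr_neq0 // mulf_neq0 ?q_factorial_neq0.
Qed.

(** This absorption identity is the recursion that the sizes of rank levels
    satisfy in [card_interval]. *)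
Lemma mul_gauss_binom_diag q n m :
  q_number q m.+1 * gauss_binom q n m.+1 = q_number q n * gauss_binom q n.-1 m.
Proof.
case: n => [|n]; first by rewrite q_number0 gauss_binom_small // mulr0 mul0r.
have [lemn|ltnm] := leqP m n; last by rewrite !gauss_binom_small // !mulr0.
rewrite /= !gauss_binom_sub // subSS !q_factorialS.
by field; rewrite !q_number_neq0 !q_factorial_neq0.
Qed.

Lemma gauss_binom_pascal q n m :
  gauss_binom q n.+1 m.+1 =
  gauss_binom q n m + q%:R ^+ m.+1 * gauss_binom q n m.+1.
Proof.
have [lemn|ltnm] := leqP m n; last first.
  by rewrite !gauss_binom_small ?mulr0 ?addr0 // ltnW.
apply: (mulfI (q_number_neq0 q m)).
rewrite mul_gauss_binom_diag /= gauss_binomSr.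
rewrite -{1}(subnKC lemn) -addSn q_numberD.
by field; rewrite q_number_neq0.
Qed.

(** Both sides are the q-trinomial coefficient with parts m, l, n - m - l. *)
Lemma gauss_binom_revision q n m l : (m <= n)%N ->
  gauss_binom q (m + l) m * gauss_binom q n (m + l) =
  gauss_binom q n m * gauss_binom q (n - m) l.
Proof.
move=> lemn; have [le|lt] := leqP (m + l) n; last first.
  rewrite (gauss_binom_small _ lt) (@gauss_binom_small _ (n - m)) ?mulr0 //.
  by rewrite ltn_subLR.
rewrite gauss_binom_factorial !gauss_binom_sub ?leq_subRL // subnDA.
by field; rewrite !q_factorial_neq0.
Qed.

(** Turns the quotient [v - s, t - s]_q / [k - s, t - s]_q that double counting
    produces into one with v - k at the bottom of both binomials; here
    a = t - s, b = k - t and c = v - k. *)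
Lemma gauss_binom_ratio q a b c :
  gauss_binom q (a + b + c) a =
  gauss_binom q (a + b) a *
    (gauss_binom q (a + b + c) c / gauss_binom q (b + c) c).
Proof.
rewrite {2}[(a + b + c)%N]addnC -addnA [X in _ / gauss_binom _ X _]addnC.
rewrite !gauss_binom_factorial.
rewrite [(b + c)%N]addnC [(a + (c + b))%N]addnCA.
by field; rewrite !q_factorial_neq0.
Qed.

(** The case x = 1 of the q-binomial theorem for the product of the 1 - x q^i,
    i < n, which has a zero factor at i = 0 unless n = 0. By the q-Pascal rule
    the sum telescopes. *)
Lemma gauss_binom_alternating_sum q n N : (n < N)%N ->
  \sum_(0 <= j < N) (-1) ^+ j * q%:R ^+ 'C(j, 2) * gauss_binom q n j =
  (n == 0)%:R.
Proof.
case: n N => [|n] [|N] // ltnN.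
  rewrite big_nat_recl // big1 ?addr0 ?gauss_binom0 ?mulr1 // => j _.
  by rewrite gauss_binom_small ?mulr0.
rewrite big_nat_recl //.
(* The j-th term is w j - w (j - 1): the q-Pascal rule splits it in two, and
   q^(j choose 2) * q^j = q^(j + 1 choose 2). *)
pose w j := (-1) ^+ j * q%:R ^+ 'C(j.+1, 2) * gauss_binom q n j : rat.
rewrite (eq_bigr (fun j => w j.+1 - w j)) => [|j _]; last first.
  by rewrite /w gauss_binom_pascal [in 'C(j.+2, 2)]binS bin1 exprD !exprS; ring.
rewrite telescope_sumr // /w (@gauss_binom_small _ n N) // !gauss_binom0.
by rewrite mulr0 sub0r; apply: subrr.
Qed.

(** Since [i + j, i]_q [m, i + j]_q = [m, i]_q [m - i, j]_q, this is [m, i]_q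
    times the alternating sum for m - i. *)
Lemma gauss_inversion q i m N : (m < i + N)%N ->
  \sum_(0 <= j < N) (-1) ^+ j * q%:R ^+ 'C(j, 2) *
    (gauss_binom q (i + j) i * gauss_binom q m (i + j)) = (m == i)%:R.
Proof.
move=> ltm; have [leim|ltmi] := leqP i m; last first.
  rewrite ltn_eqF // big1 // => j _.
  by rewrite (@gauss_binom_small _ m) ?mulr0 // ltn_addr.
under eq_bigr do rewrite gauss_binom_revision // mulrCA.
rewrite -mulr_sumr gauss_binom_alternating_sum ?ltn_subLR //.
rewrite subn_eq0 eqn_leq leim andbT.
case: leqP => [lemi|_]; last by rewrite mulr0.
have -> : m = i by apply/eqP; rewrite eqn_leq lemi.
by rewrite -[X in gauss_binom _ X _]addn0 gauss_binom_factorial addn0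
  /q_factorial [\prod_(_ < 0) _]big_ord0 !mulr1 divff // q_factorial_neq0.
Qed.

(** * Lattices graded like subspaces *)

Lemma double_counting (S T : finType) (A : {set S}) (B : {set T})
    (R : S -> T -> bool) :
  (\sum_(x in A) #|[set y in B | R x y]| =
   \sum_(y in B) #|[set x in A | R x y]|)%N.
Proof.
under eq_bigr do rewrite -sum1dep_card.
under [RHS]eq_bigr do rewrite -sum1dep_card.
rewrite (exchange_big_dep (mem B)) //= => [|x y _ /andP[]//].
by apply: eq_bigr => y By; apply: eq_bigl => x; rewrite By.
Qed.

(** The elements counted by the last condition are the covers of x below y: for
    subspaces, the points of the projective space of the quotient y / x. *)
Definition q_graded (q : nat) d (L : finTBLatticeType d) (rk : L -> nat) :=
  [/\ rk \bot%O = 0%N, {homo rk : x y / (x < y)%O >-> (x < y)%N}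
    & forall x y, (x <= y)%O ->
        #|[set z | (x <= z <= y)%O & rk z == (rk x).+1]|%:R =
        q_number q (rk y - rk x)].

Section QGraded.
Context (q : nat) d (L : finTBLatticeType d) (rk : L -> nat).
Hypothesis rkP : q_graded q rk.
Implicit Types (x y z : L) (D : {set L}).

Lemma rk_le_eq x y : (x <= y)%O -> (rk y <= rk x)%N -> x = y.
Proof.
case: rkP => _ rklt _; rewrite le_eqVlt => /predU1P[//|/rklt].
by rewrite ltnNge => /negPf ->.
Qed.

(** By induction on s: the pairs (p, z) with p covering x and z of rank
    rk x + s + 1 above p are counted by p with the induction hypothesis, and by
    z with the axiom on covers, applied between x and z. *)
Lemma card_interval s x y : (x <= y)%O ->
  #|[set z | (x <= z <= y)%O & rk z == (rk x + s)%N]|%:R =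
  gauss_binom q (rk y - rk x) s.
Proof.
elim: s x => [|s IHs] x lexy.
  rewrite gauss_binom0 (_ : [set z | _ & _] = [set x]) ?cards1 //.
  apply/setP => z; rewrite !inE addn0; apply/andP/eqP => [|->].
    by move=> [/andP[lexz _] /eqP rkz]; rewrite [RHS](rk_le_eq lexz) ?rkz.
  by rewrite lexx lexy.
apply: (mulfI (q_number_neq0 q s)); rewrite mul_gauss_binom_diag.
case: (rkP) => _ _ covers; rewrite -covers //.
have /(congr1 (fun n => n%:R : rat)) := double_counting
  [set z | (x <= z <= y)%O & rk z == (rk x).+1]
  [set z | (x <= z <= y)%O & rk z == (rk x + s.+1)%N] (fun p z => (p <= z)%O).
rewrite !natr_sum (eq_bigr (fun=> gauss_binom q (rk y - rk x).-1 s)); last first.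
  move=> p; rewrite inE => /andP[/andP[lexp lepy] /eqP rkp].
  rewrite -subnS -rkp -IHs //; congr (#|pred_of_set _|%:R).
  apply/setP => z; rewrite !inE rkp addSnnS.
  have [lepz|] := boolP (p <= z)%O; last by rewrite andbF.
  by rewrite (le_trans lexp lepz) andbT.
rewrite [RHS](eq_bigr (fun=> q_number q s.+1)); last first.
  move=> z; rewrite inE => /andP[/andP[lexz lezy] /eqP rkz].
  rewrite -(addKn (rk x) s.+1) -rkz -covers //; congr (#|pred_of_set _|%:R).
  apply/setP => p; rewrite !inE.
  have [lepz|] := boolP (p <= z)%O; last by rewrite !andbF.
  by rewrite (le_trans lepz lezy) !andbT.
by rewrite !sumr_const => eqPZ; rewrite mulr_natl mulr_natr eqPZ.
Qed.

Lemma exists_rank s x y : (x <= y)%O -> (rk x <= s <= rk y)%N ->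
  exists z, [/\ (x <= z)%O, (z <= y)%O & rk z = s].
Proof.
move=> lexy /andP[lexs lesy]; have := card_interval (s - rk x) lexy.
rewrite subnKC //.
have [->|[z]] := set_0Vmem [set z | (x <= z <= y)%O & rk z == s].
  by move/esym/eqP; rewrite cards0 (negPf (gauss_binom_neq0 _ _)) ?leq_sub2r.
by rewrite !inE => /andP[/andP[? ?] /eqP]; exists z.
Qed.

(** * Steiner systems in graded lattices *)

Definition lattice_steiner t k D :=
  (forall B, B \in D -> rk B = k) /\
  (forall A, rk A = t -> exists! B, B \in D /\ (A <= B)%O).

Section Blocks.
Variables (t k v : nat) (D : {set L}).
Hypotheses (letk : (t <= k)%N) (lekv : (k <= v)%N).
Hypotheses (rkT : rk \top%O = v) (steinerD : lattice_steiner t k D).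

(** Double counting of the pairs (z, B) with x <= z <= B and rk z = t: every
    z belongs to one pair, and every block B above x to [k - rk x, t - rk x]_q
    pairs. *)
Lemma card_blocks_above x : (rk x <= t)%N ->
  #|[set B in D | (x <= B)%O]|%:R =
  gauss_binom q (v - rk x) (v - k) / gauss_binom q (v - t) (v - k).
Proof.
case: steinerD => rkD uniqD lext.
have /(congr1 (fun n => n%:R : rat)) := double_counting
  [set z | (x <= z <= \top)%O & rk z == (rk x + (t - rk x))%N]
  [set B in D | (x <= B)%O] (fun z B => (z <= B)%O).
rewrite !natr_sum (eq_bigr (fun=> 1)); last first.
  move=> z; rewrite inE subnKC // => /andP[/andP[lexz _] /eqP rkz].
  have [B [[DB lezB] uniqB]] := uniqD z rkz.
  suff -> : [set B' in [set B' in D | (x <= B')%O] | (z <= B')%O] = [set B].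
    by rewrite cards1.
  apply/setP => B'; rewrite !inE -andbA; apply/and3P/eqP => [[DB' _ lezB']|->].
    by rewrite (uniqB B').
  by rewrite DB lezB (le_trans lexz lezB).
rewrite [RHS](eq_bigr (fun=> gauss_binom q (k - rk x) (t - rk x))); last first.
  move=> B; rewrite inE => /andP[DB lexB].
  rewrite -(rkD B DB) -card_interval //; congr (#|pred_of_set _|%:R).
  by apply/setP => z; rewrite !inE lex1 andbT -!andbA andbCA andbC -!andbA.
rewrite !sumr_const card_interval ?lex1 // rkT => eqn.
have := gauss_binom_ratio q (t - rk x) (k - t) (v - k).
have -> : (t - rk x + (k - t) + (v - k) = v - rk x)%N by lia.
have -> : (t - rk x + (k - t) = k - rk x)%N by lia.
have -> : (k - t + (v - k) = v - t)%N by lia.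
have nz : gauss_binom q (k - rk x) (t - rk x) != 0.
  by rewrite gauss_binom_neq0 ?leq_sub2r.
by move=> ratio; apply: (mulfI nz); rewrite -ratio eqn mulr_natr.
Qed.

Lemma rk_meet_blocks B B' : B \in D -> B' \in D -> B' != B ->
  (rk (B `&` B')%O < t)%N.
Proof.
move=> DB DB'; apply: contraR; rewrite -leqNgt => letm.
have [rk0 _ _] := rkP; have [_ uniqD] := steinerD.
have [|z [_ lez rkz]] := @exists_rank t _ _ (le0x (B `&` B')%O).
  by rewrite rk0.
have [C [_ uniqC]] := uniqD z rkz; move: lez; rewrite lexI => /andP[lezB lezB'].
by rewrite -(uniqC B) // -(uniqC B').
Qed.

(** The binomial moments of the intersection distribution: both sides count
    the pairs (z, B') with rk z = j, z <= B, z <= B' and B' <> B. The - 1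
    removes B itself from the blocks above z. *)
Lemma sum_gauss_meet B j : B \in D -> (j <= t)%N ->
  \sum_(B' in D :\ B) gauss_binom q (rk (B `&` B')%O) j =
  gauss_binom q k j *
    (gauss_binom q (v - j) (v - k) / gauss_binom q (v - t) (v - k) - 1).
Proof.
move=> DB lejt; have [rk0 _ _] := rkP; have [rkD _] := steinerD.
have /(congr1 (fun n => n%:R : rat)) := double_counting
  [set z | (\bot <= z <= B)%O & rk z == (rk \bot%O + j)%N]
  (D :\ B) (fun z B' => (z <= B')%O).
rewrite !natr_sum => eqn.
transitivity (\sum_(B' in D :\ B)
  #|[set z in [set z | (\bot <= z <= B)%O & rk z == (rk \bot%O + j)%N]
      | (z <= B')%O]|%:R : rat).
  apply: eq_bigr => B' _; rewrite -[rk (B `&` B')%O]subn0 -rk0.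
  rewrite -card_interval ?le0x //; congr (#|pred_of_set _|%:R).
  by apply/setP => z; rewrite !inE lexI le0x /= andbAC.
rewrite -eqn (eq_bigr (fun=> gauss_binom q (v - j) (v - k) /
    gauss_binom q (v - t) (v - k) - 1)); last first.
  move=> z; rewrite inE rk0 add0n => /andP[/andP[_ lezB] /eqP rkz].
  rewrite -{1}rkz -card_blocks_above ?rkz //.
  rewrite [X in _ = X%:R - 1](cardsD1 B) inE DB lezB addnC natrD addrK.
  by congr (#|pred_of_set _|%:R); apply/setP => B'; rewrite !inE andbA.
by rewrite sumr_const -[LHS]mulr_natl card_interval ?le0x // rk0 subn0 rkD.
Qed.

Theorem card_blocks_meeting B i : B \in D -> (i <= k)%N ->
  #|[set B' in D | rk (B `&` B')%O == i]|%:R =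
  block_intersection_number t v k q i.
Proof.
move=> DB leik; rewrite /block_intersection_number; have [rkD _] := steinerD.
case: ltnP => [ltit|leti]; last first.
  case: ltnP => [ltik|leki].
    rewrite (_ : [set _ in _ | _] = set0) ?cards0 //.
    apply/setP => B'; rewrite !inE; apply/negP => /andP[DB' /eqP rkBB'].
    have [eqB|neqB] := eqVneq B' B.
      by move: rkBB' ltik; rewrite eqB meetxx rkD // => ->; rewrite ltnn.
    by move: (rk_meet_blocks DB DB' neqB); rewrite rkBB' ltnNge leti.
  rewrite (_ : [set _ in _ | _] = [set B]) ?cards1 //.
  have {leik leki} eqik: i = k by apply/eqP; rewrite eqn_leq leik.
  apply/setP => B'; rewrite !inE; apply/andP/eqP => [[DB' /eqP rkBB']|->].
    apply: contraTeq leti => /(rk_meet_blocks DB DB').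
    by rewrite rkBB' ltnNge.
  by rewrite meetxx rkD // eqik.
(* B itself does not count, since rk B = k > i. *)
have -> : #|[set B' in D | rk (B `&` B')%O == i]|%:R =
    \sum_(B' in D :\ B) (rk (B `&` B')%O == i)%:R :> rat.
  rewrite -sum1dep_card natr_sum big_mkcondr [LHS](big_setD1 B) //=.
  rewrite meetxx rkD // gtn_eqF ?add0r; last exact: leq_trans letk.
  by apply: eq_bigr => B' _; case: ifP.
transitivity (\sum_(B' in D :\ B) \sum_(0 <= j < t - i)
    (-1) ^+ j * q%:R ^+ 'C(j, 2) * (gauss_binom q (i + j) i *
      gauss_binom q (rk (B `&` B')%O) (i + j))).
  apply: eq_bigr => B'; rewrite !inE => /andP[neqB DB'].
  by rewrite gauss_inversion // subnKC ?rk_meet_blocks // ltnW.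
rewrite exchange_big mulr_sumr; apply: eq_big_nat => j /andP[_ ltj].
rewrite -mulr_sumr -mulr_sumr sum_gauss_meet //; last first.
  by rewrite -(subnKC (ltnW ltit)) leq_add2l ltnW.
rewrite [gauss_binom q (i + j) i * _]mulrA gauss_binom_revision // subnDA.
by ring.
Qed.

End Blocks.
End QGraded.

(** * Subsets and subspaces *)

Import Order.DefaultSetSubsetOrder.

Lemma subset_graded (T : finType) : q_graded 1 (fun A : {set T} => #|A|).
Proof.
split=> [|A B|A B sAB]; first exact: cards0.
  by rewrite lt_neqAle -properEneq; apply: proper_card.
rewrite /q_number (eq_bigr (fun=> 1)) => [|i _]; last by rewrite expr1n.
rewrite sumr_const card_ord -cardsDS //.
rewrite -[#|B :\: A|](@card_in_imset _ _ (fun x => x |: A)) => [|x y]; last first.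
  rewrite !inE => /andP[xA _] _ /setP/(_ x).
  by rewrite !inE eqxx (negPf xA) !orbF => /esym/eqP.
congr (#|pred_of_set _|%:R); apply/setP => C; rewrite !inE.
apply/andP/imsetP => [[/andP[sAC sCB] /eqP cardC]|[x /setDP[Bx Ax] ->]].
  have /eqP/cards1P[x defx]: #|C :\: A| = 1%N by rewrite cardsDS // cardC subSnn.
  have: x \in C :\: A by rewrite defx set11.
  rewrite inE => /andP[Ax Cx]; exists x; first by rewrite inE Ax (subsetP sCB).
  rewrite -defx; apply/setP => y; rewrite !inE.
  by case: (boolP (y \in A)) => [/(subsetP sAC) ->|_]; rewrite ?orbF.
rewrite cardsU1 Ax; split=> //; apply/andP; split; first exact: subsetUr.
by apply/subUsetP; rewrite sub1set.
Qed.

Fact subspace_display : Order.disp_t. Proof. exact: Order.Disp tt tt. Qed.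

HB.instance Definition _ (F : finFieldType) (V : vectType F) :=
  Order.Le_isPOrder.Build subspace_display {vspace V}
    (@subvv F V) (@subv_anti F V) (@subv_trans F V).
HB.instance Definition _ (F : finFieldType) (V : vectType F) :=
  Order.POrder_MeetJoin_isLattice.Build subspace_display {vspace V}
    (@subv_cap F V) (@subv_add F V).
HB.instance Definition _ (F : finFieldType) (V : vectType F) :=
  Order.hasBottom.Build subspace_display {vspace V} (@sub0v F V).
HB.instance Definition _ (F : finFieldType) (V : vectType F) :=
  Order.hasTop.Build subspace_display {vspace V} (@subvf F V).

(** The alias [finvect_type V] carries the finite structure of V. *)
Lemma card_vspace_elements (F : finFieldType) (V : vectType F)
    (A : {vspace V}) :
  #|[set x : finvect_type V | x \in A]| = (#|F| ^ \dim A)%N.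
Proof.
(* Counting the elements of a subspace takes V as an explicit pair of a type
   and a structure, which an abstract V is not convertible to. *)
case: V A => T vectT A.
rewrite -(@card_vspace F (finvect_type (Vector.Pack vectT)) vectT A).
by apply: eq_card => x; rewrite inE.
Qed.

Lemma card_vspaceD (F : finFieldType) (V : vectType F) (A B : {vspace V}) :
  (A <= B)%VS ->
  #|[set x : finvect_type V | (x \in B) && (x \notin A)]|%:R =
  #|F|%:R ^+ \dim B - #|F|%:R ^+ \dim A :> rat.
Proof.
move=> sAB; have sub_elements :
    [set x : finvect_type V | x \in A] \subset
    [set x : finvect_type V | x \in B].
  by apply/subsetP => x; rewrite !inE; apply: (subvP sAB).
rewrite -!natrX -!card_vspace_elements -natrB ?subset_leq_card // -cardsDS //.
by congr (#|pred_of_set _|%:R); apply/setP => x; rewrite !inE andbC.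
Qed.

Lemma dim_addv_line (F : fieldType) (V : vectType F) (A : {vspace V}) (x : V) :
  x \notin A -> \dim (A + <[x]>) = (\dim A).+1.
Proof.
move=> Ax; rewrite dimv_disjoint_sum.
  by rewrite dim_vline; case: eqP Ax => [->|_ _]; rewrite ?mem0v // addn1.
apply/eqP; rewrite -subv0; apply/subvP => y /memv_capP[Ay /vlineP[c defy]].
rewrite memv0; apply: contraR Ax => nzy.
have nzc : c != 0 by apply: contraNneq nzy => c0; rewrite defy c0 scale0r.
by rewrite -[x]scale1r -(mulVf nzc) -scalerA -defy memvZ.
Qed.

(** Each vector x of B outside A spans with A one cover of A, and each
    cover C arises from the q^(dim A + 1) - q^(dim A) vectors of C outside A.
    So the number of covers in B is (q^(dim B) - q^(dim A)) divided by that. *)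
Lemma vspace_graded (F : finFieldType) (V : vectType F) :
  q_graded #|F| (fun A : {vspace V} => \dim A).
Proof.
split=> [|A B|A B sAB]; first exact: dimv0.
  rewrite lt_neqAle => /andP[neqAB leAB].
  by rewrite ltn_neqAle (dimv_leqif_eq leAB) neqAB dimvS.
have q1 : #|F|%:R - 1 != 0 :> rat.
  by rewrite subr_eq0 pnatr_eq1 gtn_eqF ?finNzRing_gt1.
pose q := #|F|%:R : rat.
pose Z := [set C | (A <= C <= B)%O & \dim C == (\dim A).+1].
have nzqA : q ^+ \dim A * (q - 1) != 0.
  by rewrite mulf_neq0 // expf_neq0 // pnatr_eq0 -lt0n ltnW ?finNzRing_gt1.
apply: (mulIf nzqA).
rewrite [RHS]mulrCA q_number_geometric [RHS]mulrBr mulr1 -exprD.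
rewrite subnKC ?dimvS // -(card_vspaceD sAB).
have /(congr1 (fun n => n%:R : rat)) := double_counting
  [set x : finvect_type V | (x \in B) && (x \notin A)] Z
  (fun x C => (x : V) \in C).
rewrite !natr_sum (eq_bigr (fun=> 1)); last first.
  move=> x; rewrite inE => /andP[Bx Ax].
  have dimAx := dim_addv_line Ax.
  suff -> : [set C in Z | x \in C] = [set (A + <[x : V]>)%VS] by rewrite cards1.
  apply/setP => C; rewrite !inE; apply/andP/eqP.
    move=> [/andP[/andP[sAC sCB] /eqP dimC] Cx]; apply/esym/eqP.
    by rewrite eqEdim subv_add [(A <= C)%VS]sAC dimAx dimC leqnn andbT -memvE.
  move=> ->.
  rewrite dimAx eqxx andbT; split; last first.
    exact: (subvP (addvSr A <[x : V]>) _ (memv_line x)).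
  apply/andP; split; first exact: (addvSl A).
  by rewrite [(_ <= _)%O]subv_add [(A <= B)%VS]sAB -memvE.
rewrite [RHS](eq_bigr (fun=> q ^+ \dim A * (q - 1))); last first.
  move=> C; rewrite inE => /andP[/andP[sAC sCB] /eqP dimC].
  rewrite mulrBr mulr1 -exprSr -dimC -card_vspaceD //.
  congr (#|pred_of_set _|%:R); apply/setP => x; rewrite !inE.
  have [Cx|] := boolP (x \in C); last by rewrite andbF.
  by rewrite (subvP sCB) ?andbT.
by rewrite !sumr_const => ->; rewrite mulr_natl.
Qed.

Lemma alphaE (t k v : nat) (T : finType) (D : {set {set T}}) B i :
  (t <= k)%N -> (k <= v)%N -> steiner t v k D -> B \in D -> (i <= k)%N ->
  (alpha D B i)%:R = block_intersection_number t v k 1 i.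
Proof.
move=> letk lekv [cardT cardB uniqB].
apply: (card_blocks_meeting (subset_graded T)) => //.
by rewrite -cardT -cardsT.
Qed.

Lemma q_alphaE (t k v q : nat) (F : finFieldType) (V : vectType F)
    (D : {set {vspace V}}) B i :
  (t <= k)%N -> (k <= v)%N -> q_steiner t v k q D -> B \in D -> (i <= k)%N ->
  (q_alpha D B i)%:R = block_intersection_number t v k q i.
Proof.
move=> letk lekv [<- dimV dimB uniqB].
exact: (card_blocks_meeting (vspace_graded V)).
Qed.

Theorem corollary6 (t k v : nat) (htk : (t <= k)%N) (hkv : (k <= v)%N) :
  [/\ forall (T : finType) (D : {set {set T}}), steiner t v k D ->
        forall B : {set T}, B \in D -> forall i : nat, (i <= k)%N ->
          (alpha D B i)%:R = block_intersection_number t v k 1 i,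
      forall (q : nat) (F : finFieldType) (V : vectType F)
        (D : {set {vspace V}}), q_steiner t v k q D ->
        forall B : {vspace V}, B \in D -> forall i : nat, (i <= k)%N ->
          (q_alpha D B i)%:R = block_intersection_number t v k q i,
      forall (T1 T2 : finType) (D1 : {set {set T1}}) (D2 : {set {set T2}}),
        steiner t v k D1 -> steiner t v k D2 ->
        forall (B1 : {set T1}) (B2 : {set T2}), B1 \in D1 -> B2 \in D2 ->
        forall i : nat, (i <= k)%N -> alpha D1 B1 i = alpha D2 B2 i
    & forall (q : nat) (F1 F2 : finFieldType)
        (V1 : vectType F1) (V2 : vectType F2)
        (D1 : {set {vspace V1}}) (D2 : {set {vspace V2}}),
        q_steiner t v k q D1 -> q_steiner t v k q D2 ->
        forall (B1 : {vspace V1}) (B2 : {vspace V2}), B1 \in D1 -> B2 \in D2 ->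
        forall i : nat, (i <= k)%N -> q_alpha D1 B1 i = q_alpha D2 B2 i].
Proof.
split=> [T D stD B DB i leik|q F V D stD B DB i leik||].
- exact: alphaE stD DB leik.
- exact: q_alphaE stD DB leik.
- move=> T1 T2 D1 D2 st1 st2 B1 B2 DB1 DB2 i leik.
  apply/eqP; rewrite -(eqr_nat rat) (alphaE _ _ st1) //.
  by rewrite (alphaE _ _ st2).
- move=> q F1 F2 V1 V2 D1 D2 st1 st2 B1 B2 DB1 DB2 i leik.
  apply/eqP; rewrite -(eqr_nat rat) (q_alphaE _ _ st1) //.
  by rewrite (q_alphaE _ _ st2).
Qed.
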